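(* Let $k\geq 3$, let $m,n\ge0$ be integers, and let $A_{m|n}=T(\mathbb{C}^{m|n})$ be the free associative superalgebra over $\mathbb{C}$ on $m$ even and $n$ odd generators. There exists a constant $C_k(m,n)$ such that for all $d\ge 1$, $$\dim B_k(A_{m|n})[d]\leq C_k(m,n)\,d^{\,m+n-1}.$$
   Context: On $A=A_{m|n}$ the super commutator is $[a,b]=ab-(-1)^{|a||b|}ba$ for elements homogeneous of parities $|a|,|b|$. The lower central series is $L_1=A$, $L_{i+1}=[A,L_i]$ (span of super commutators), and $B_i(A):=L_i/L_{i+1}$. These are graded by total degree in the generators (each generator has degree 1); for a graded vector space $M$, $M[d]$ denotes its degree-$d$ component, and $\dim$ is the total dimension. *)

(* Defs.v *)
From HB Require Import structures.
From mathcomp Require Import all_boot all_order all_algebra.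
From mathcomp Require Import finmap monalg.
From mathcomp Require Import classical_sets reals complex.

Set Implicit Arguments.
Unset Strict Implicit.
Unset Printing Implicit Defensive.

Import GRing.Theory.
Local Open Scope ring_scope.
Local Open Scope classical_set_scope.

Section LinearAlgebra.
Variables (K : fieldType) (V : lmodType K).

Definition lin_span (X : set V) : set V :=
  [set v | exists (N : nat) (c : 'I_N -> K) (x : 'I_N -> V),
      (forall i, X (x i)) /\ v = \sum_(i < N) c i *: x i].

(* For subspaces U and W of V, the image U / (U `&` W) of U in V / W has
   dimension N: the classes of some e_0, ..., e_(N-1) in U form a basis. *)
Definition has_quot_dim (U W : set V) (N : nat) : Prop :=
  exists e : 'I_N -> V,
    [/\ forall i, U (e i),
        forall c : 'I_N -> K, W (\sum_(i < N) c i *: e i) -> forall i, c i = 0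
      & forall u, U u -> exists c : 'I_N -> K, W (u - \sum_(i < N) c i *: e i)].

End LinearAlgebra.

(* T(K^(m|n)), with linear basis the words in the generators; [inl i] are the
   even generators and [inr j] the odd ones. *)
Definition sword (m n : nat) := {fmonom ('I_m + 'I_n)%type}.

Notation free_salg K m n := {malg K[sword m n]}.

Section FreeSuperalgebra.
Variables (K : fieldType) (m n : nat).
Local Notation A := (free_salg K m n).

Definition odd_gen (x : 'I_m + 'I_n) : bool :=
  if x is inr _ then true else false.

Definition word_parity (w : sword m n) : bool := odd (count odd_gen w).

(* [false] is the even part and [true] the odd part. *)
Definition parity_part (p : bool) : set A :=
  [set a | forall w : sword m n, w \in msupp a -> word_parity w = p].

Definition degree_part (d : nat) : set A :=
  [set a | forall w : sword m n, w \in msupp a -> fdeg w = d].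

(* Super commutator of a and b, homogeneous of parities p and q. *)
Definition scomm (p q : bool) (a b : A) : A :=
  a * b - (-1) ^+ (p * q)%N * (b * a).

(* [A, X], for X a subspace which is graded by parity. *)
Definition scomm_space (X : set A) : set A :=
  lin_span [set c | exists (p q : bool) (a b : A),
    [/\ parity_part p a, parity_part q b, X b & c = scomm p q a b]].

(* The series is indexed from 1; the value at 0 is irrelevant. *)
Fixpoint lcs (i : nat) : set A :=
  match i with
  | 0 | 1 => setT
  | (_.+1 as j).+1 => scomm_space (lcs j)
  end.

(* dim B_k(A)[d] = N, where B_k(A) = L_k / L_(k+1). *)
Definition B_dim (k d N : nat) : Prop :=
  has_quot_dim (lcs k `&` degree_part d) (lcs k.+1) N.

End FreeSuperalgebra.

(* Main.v *)
(** Let L_i be the lower central series and M_3 = A L_3.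

    For k >= 2 one has L_(k+1) = \sum_g [g, L_k] + L_(k+2), with g running over
    the words of length at most 3. Indeed the polarized cubic identity

      [x^3,[g,c]] = 3/2 [x^2,[xg + gx,c]] - 3 [x,[xgx,c]]
                    - 1/2 [x,[x,[x,[g,c]]]] + 3/2 [x,[x,[g,[x,c]]]]

    reduces the bracket with a symmetrized product of three factors to brackets
    with shorter elements, and modulo commutators every word of length at least
    4 is a combination of such products. So dim B_(k+1)[d] is at most
    \sum_g dim B_k[d - |g|], and it remains to treat k = 2.

    There L_2 = \sum_i [x_i, A] and [A, M_3] lies in L_3, so B_2 grows no faster
    than A / M_3. In A / M_3 commutators are central and [a,b][c,d] is super
    antisymmetric in b and c, so A / M_3 is spanned by the products of an ordered
    word and an ordered product of commutators of generators in which each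
    generator is repeated in only one of the two factors: the word if it is even,
    the product of commutators if it is odd. Such products have m + n free
    exponents, of prescribed sum up to a bounded error. *)

From HB Require Import structures.
Require Import Defs.
From mathcomp Require Import all_boot all_order all_algebra.
From mathcomp Require Import finmap monalg boolp classical_sets reals complex.

Set Implicit Arguments.
Unset Strict Implicit.
Unset Printing Implicit Defensive.

Import GRing.Theory.
Local Open Scope ring_scope.
Local Open Scope classical_set_scope.

(** * Subspaces and dimensions of quotients *)

Section QuotientDimension.
Variables (K : fieldType) (V : lmodType K).
Implicit Types (U W X : set V) (E : seq V).

Lemma scalerD_ACA (c : K) (x x' y y' : V) :
  (c *: x + x') + (c *: y + y') = c *: (x + y) + (x' + y').
Proof. by rewrite scalerDr addrACA. Qed.

Definition subspace W := W 0 /\ forall c x y, W x -> W y -> W (c *: x + y).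

Section Closure.
Variables (W : set V) (sW : subspace W).

Lemma subspace0 : W 0. Proof. by case: sW. Qed.

Lemma subspaceZ c x : W x -> W (c *: x).
Proof. by move=> Wx; rewrite -[_ *: _]addr0; apply: sW.2 => //; exact: subspace0. Qed.

Lemma subspaceD x y : W x -> W y -> W (x + y).
Proof. by move=> Wx Wy; rewrite -[x]scale1r; apply: sW.2. Qed.

Lemma subspaceN x : W x -> W (- x).
Proof. by rewrite -scaleN1r; exact: subspaceZ. Qed.

Lemma subspaceB x y : W x -> W y -> W (x - y).
Proof. by move=> Wx Wy; apply: subspaceD => //; exact: subspaceN. Qed.

Lemma subspace_sum I (r : seq I) (P : pred I) (F : I -> V) :
  (forall i, P i -> W (F i)) -> W (\sum_(i <- r | P i) F i).
Proof. by move=> WF; elim/big_ind: _ => //; [exact: subspace0|exact: subspaceD]. Qed.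

Lemma subspaceMz x z : W x -> W (x *~ z).
Proof. by rewrite -scaler_int; exact: subspaceZ. Qed.

Lemma subspaceZK c x : c != 0 -> W (c *: x) -> W x.
Proof. by move=> c0 /(subspaceZ c^-1); rewrite scalerA mulVf // scale1r. Qed.

End Closure.

Lemma subspace_lin_span X : subspace (lin_span X).
Proof.
split; first by exists 0%N, (fun=> 0), (fun=> 0); split=> [[]//|]; rewrite big_ord0.
move=> c _ _ [N [a [x [Xx ->]]]] [M [b [y [Xy ->]]]].
pose ab (i : 'I_(N + M)) := match split i with inl j => c * a j | inr j => b j end.
pose xy (i : 'I_(N + M)) := match split i with inl j => x j | inr j => y j end.
exists (N + M)%N, ab, xy; split=> [i|]; first by rewrite /xy; case: split.
rewrite big_split_ord scaler_sumr; congr (_ + _); apply: eq_bigr => i _.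
  by rewrite /ab /xy (unsplitK (inl i)) scalerA.
by rewrite /ab /xy (unsplitK (inr i)).
Qed.

Lemma lin_span_gen X x : X x -> lin_span X x.
Proof.
by move=> Xx; exists 1%N, (fun=> 1), (fun=> x); split=> //; rewrite big_ord1 scale1r.
Qed.

Lemma lin_span_sub X W : subspace W -> X `<=` W -> lin_span X `<=` W.
Proof.
move=> sW XW _ [N [c [x [Xx ->]]]]; apply: subspace_sum => // i _.
by apply: subspaceZ => //; exact: XW.
Qed.

(** The preimage in V of the span of [E] in V / W. Since [E] is a sequence, [size E] can serve as a
    bound on a dimension. *)
Definition span_mod E W : set V :=
  [set u | exists c : 'I_(size E) -> K, W (u - \sum_i c i *: E`_i)].

Lemma subspace_span_mod E W : subspace W -> subspace (span_mod E W).
Proof.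
move=> sW; split.
  exists (fun=> 0); rewrite big1 ?subr0; first exact: subspace0.
  by move=> i _; rewrite scale0r.
move=> c x y [a Wa] [b Wb]; exists (fun i => c * a i + b i).
have -> : \sum_i (c * a i + b i) *: E`_i
        = c *: \sum_i a i *: E`_i + \sum_i b i *: E`_i.
  rewrite scaler_sumr -big_split; apply: eq_bigr => i _.
  by rewrite scalerDl scalerA.
by rewrite opprD addrACA -scalerBr; apply: sW.2.
Qed.

Lemma span_mod_mem E W x : subspace W -> x \in E -> span_mod E W x.
Proof.
move=> sW xE; have ltx : (index x E < size E)%N by rewrite index_mem.
exists (fun i => (i == Ordinal ltx)%:R); rewrite (bigD1 (Ordinal ltx)) //= eqxx.
rewrite scale1r nth_index // big1 ?addr0 ?subrr; first exact: subspace0.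
by move=> i /negPf->; rewrite scale0r.
Qed.

Lemma sub_span_mod E W : subspace W -> W `<=` span_mod E W.
Proof.
move=> sW x Wx; exists (fun=> 0); rewrite big1 ?subr0 // => i _.
by rewrite scale0r.
Qed.

Lemma span_mod_sub E W W' : subspace W' -> {in E, forall x, W' x} ->
  W `<=` W' -> span_mod E W `<=` W'.
Proof.
move=> sW' EW' WW' u [c Wc]; rewrite -[u](subrK (\sum_i c i *: E`_i)).
apply: subspaceD => //; first exact: WW'.
by apply: subspace_sum => // i _; apply: subspaceZ => //; apply/EW'/mem_nth.
Qed.

(** Families in U that are independent modulo W have at most [size E] members, so there is one of
    maximal size, and maximality makes it a basis. *)
Lemma has_quot_dim_le U W E : subspace U -> subspace W -> U `<=` span_mod E W ->
  exists2 N, (N <= size E)%N & has_quot_dim U W N.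
Proof.
move=> sU sW UE.
pose indep N := exists e : 'I_N -> V, (forall i, U (e i)) /\
  forall c : 'I_N -> K, W (\sum_(i < N) c i *: e i) -> forall i, c i = 0.
have indep_le N : indep N -> (N <= size E)%N.
  case=> e [Ue We].
  have /choice[a Wa] : forall i, exists c : 'I_(size E) -> K,
      W (e i - \sum_j c j *: E`_j) by move=> i; exact: UE.
  rewrite leqNgt; apply/negP => ltN.
  (* Coordinates of the e_i over [E] modulo W: if N exceeded [size E], a nonzero row of the kernel
     would be a dependency modulo W. *)
  pose M : 'M[K]_(N, size E) := \matrix_(i, j) a i j.
  have [i0 /eqP ker0] : exists i, row i (kermx M) != 0.
    apply: contrapT => /forallNP ker0.
    have : kermx M = 0.
      by apply/row_matrixP => i; rewrite row0; have /negP := ker0 i; rewrite negbK => /eqP.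
    move/eqP; rewrite kermx_eq0 /row_free => /eqP rM.
    by have := rank_leq_col M; rewrite rM leqNgt ltN.
  apply: ker0; apply/rowP => i; rewrite [RHS]mxE; move: i.
  apply: We.
  have : row i0 (kermx M) *m M = 0 by apply/sub_kermxP; exact: row_sub.
  move: (row i0 (kermx M)) => v vM.
  have -> : \sum_(i < N) v 0 i *: e i
      = \sum_i v 0 i *: (e i - \sum_j a i j *: E`_j).
    under [RHS]eq_bigr do rewrite scalerBr.
    rewrite sumrB -[LHS]subr0; congr (_ - _); apply/esym.
    under eq_bigr do rewrite scaler_sumr.
    rewrite exchange_big big1 // => j _.
    under eq_bigr do rewrite scalerA.
    rewrite -scaler_suml; have /rowP/(_ j) := vM.
    rewrite !mxE; under eq_bigr do rewrite mxE.
    by move->; rewrite scale0r.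
  by apply: subspace_sum => // i _; exact: subspaceZ.
have ex0 : exists N, `[< indep N >].
  by exists 0%N; apply/asboolP; exists (fun=> 0); split=> [[]|? ? []].
have [] := ex_maxnP ex0 (fun N iN => indep_le N (asboolW iN)).
move=> N /asboolP iN maxN; exists N; first exact: indep_le.
have [e [Ue We]] := iN; exists e; split=> // u Uu.
apply: contrapT => nu.
suff : indep N.+1 by move=> /asboolP/maxN; rewrite ltnn.
(* The vector [u] is put in front of the maximal family; a relation with nonzero first coefficient
   would express [u] through [e]. *)
exists (fun i => oapp e u (unlift ord0 i)); split.
  by move=> i; case: unlift.
move=> c; rewrite big_ord_recl unlift_none /= => Wc.
have Wc' : W (c ord0 *: u + \sum_(i < N) c (lift ord0 i) *: e i).
  by move: Wc; under eq_bigr do rewrite liftK.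
have c0 : c ord0 = 0.
  apply/eqP/negP => /negP c0; apply: nu; exists (fun i => - (c ord0)^-1 * c (lift ord0 i)).
  have := subspaceZ sW (c ord0)^-1 Wc'.
  rewrite scalerDr scalerA mulVf // scale1r scaler_sumr.
  congr (W (u + _)); rewrite -sumrN; apply: eq_bigr => i _.
  by rewrite scalerA mulNr scaleNr opprK.
move: Wc'; rewrite c0 scale0r add0r => /We cl i.
by case: (unliftP ord0 i) => [j|] ->.
Qed.

End QuotientDimension.

Lemma subspace_preim (K : fieldType) (U V : lmodType K) (W : set V) (f : U -> V) :
  (forall c x y, f (c *: x + y) = c *: f x + f y) -> subspace W ->
  subspace [set x | W (f x)].
Proof.
move=> lin_f sW; split=> [|c x y Wx Wy] /=; last by rewrite lin_f; exact: sW.2.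
suff -> : f 0 = 0 by exact: subspace0.
have := lin_f (-1) 0 0; rewrite scaler0 addr0 => ->.
by rewrite scaleN1r addNr.
Qed.

(** The equalizer is the preimage of 0 under f - g. Equalities between linear maps can thus be
    checked on a spanning set. *)
Lemma subspace_eq (K : fieldType) (U V : lmodType K) (f g : U -> V) :
  (forall c x y, f (c *: x + y) = c *: f x + f y) ->
  (forall c x y, g (c *: x + y) = c *: g x + g y) ->
  subspace [set x | f x = g x].
Proof.
move=> lin_f lin_g; have lin_fg c x y :
    f (c *: x + y) - g (c *: x + y) = c *: (f x - g x) + (f y - g y).
  by rewrite lin_f lin_g scalerBr opprD addrACA.
have [z D] := subspace_preim (f := fun x => f x - g x) lin_fg (W := [set 0])
  (conj erefl (fun c x y (x0 : x = 0) (y0 : y = 0) =>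
    etrans (congr2 _ (congr1 _ x0) y0) (etrans (congr1 (+%R^~ 0) (scaler0 _ c)) (addr0 0)))).
split=> [|c x y /= Hx Hy]; first exact: subr0_eq z.
by apply: subr0_eq; apply: D; rewrite /= ?Hx ?Hy subrr.
Qed.

(** * Restriction of the support in a monoid algebra *)

Section MonoidAlgebra.
Variables (K : fieldType) (M : monomType).
Implicit Types (a b : {malg K[M]}) (w : M) (P : pred M).

Lemma malgUZ c w : << c *g w >> = c *: << w >> :> {malg K[M]}.
Proof. by apply/malgP => v; rewrite mcoeffZ !mcoeffU mulr_natr. Qed.

Lemma malgUM u v : << u >> * << v >> = << mmul u v >> :> {malg K[M]}.
Proof. by rewrite malgM_def fgmulUU mulr1. Qed.

Lemma malgCA c a : a * c%:MP = c%:MP * a.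
Proof.
rewrite !malgM_def fgmulUg fgmulgU; apply: eq_bigr => w _.
by rewrite mulrC mul1m mulm1.
Qed.

Lemma malg_scalerAr c a b : a * (c *: b) = c *: (a * b).
Proof. by rewrite -!mul_malgC mulrA malgCA mulrA. Qed.

Lemma subspace_words (W : set {malg K[M]}) :
  subspace W -> (forall w, W << w >>) -> forall a, W a.
Proof.
move=> sW Ww a; rewrite (monalgE a); apply: subspace_sum => // w _.
by rewrite malgUZ; apply: subspaceZ.
Qed.

(** The projection onto the span of the words satisfying [P]; the parity and degree components are
    both of this kind. *)
Definition restr P a : {malg K[M]} := \sum_(w <- msupp a | P w) << a@_w *g w >>.

Lemma mcoeff_restr P a w : (restr P a)@_w = a@_w *+ P w.
Proof.
rewrite raddf_sum /= big_mkcond /=.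
under eq_bigr do rewrite mcoeffU.
have [wa|wa] := boolP (w \in msupp a); last first.
  rewrite big1_seq ?mcoeff_outdom ?mul0rn // => v /= va; case: ifP => // _.
  by case: eqVneq => // vw; rewrite -vw va in wa.
rewrite (big_fsetD1 w) //= eqxx big1_seq ?addr0; first by case: (P w).
move=> v /=; rewrite in_fsetD1 => /andP[/negPf-> _]; by case: ifP.
Qed.

Lemma restr_linear P c a b : restr P (c *: a + b) = c *: restr P a + restr P b.
Proof.
apply/malgP => w; rewrite mcoeff_restr !mcoeffD !mcoeffZ !mcoeff_restr.
by rewrite mulrnDl mulrnAr.
Qed.

Lemma restrU P w : restr P << w >> = if P w then << w >> else 0.
Proof.
apply/malgP => v; rewrite mcoeff_restr mcoeffU1.
by case: eqVneq => [->|/negPf wv]; case: ifP; rewrite ?mul0rn ?mcoeffU1 ?mcoeff0 ?eqxx ?wv.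
Qed.

Lemma restr_id P a : (forall w, w \in msupp a -> P w) <-> restr P a = a.
Proof.
split=> [Pa|<- w].
  apply/malgP => w; rewrite mcoeff_restr; case: msuppP => [wa|_]; rewrite ?mul0rn //.
  by rewrite Pa.
by rewrite -mcoeff_neq0 mcoeff_restr; case: (P w) => //; rewrite eqxx.
Qed.

End MonoidAlgebra.

(** * Permutations generated by adjacent transpositions *)

Section Permutations.
Variable T : eqType.
Implicit Types (s t : seq T) (x y : T).

Lemma perm_adjacent_ind (Q : seq T -> Prop) :
  (forall s1 x y s2, Q (s1 ++ x :: y :: s2) -> Q (s1 ++ y :: x :: s2)) ->
  forall s t, perm_eq s t -> Q s -> Q t.
Proof.
(* A letter moves past a block by adjacent swaps; two blocks are then exchanged letter by letter. *)
move=> Qswap; have Qmove x s1 s2 s3 : Q (s1 ++ x :: s2 ++ s3) -> Q (s1 ++ s2 ++ x :: s3).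
  elim: s2 s1 => [|y s2 IH] s1 //= /Qswap.
  by rewrite -cat_rcons => /IH; rewrite cat_rcons.
apply: catCA_perm_ind => s1 s2 s3; rewrite -[X in Q X -> _]cat0s -[X in _ -> Q X]cat0s.
elim: s1 [::] => [|x s1 IH] s0 //=.
by rewrite -cat_rcons => /IH; rewrite cat_rcons; exact: Qmove.
Qed.

End Permutations.

(** * Multilinear super identities *)

(* [SJo] is the super anticommutator, and [SKos e] is [e] times the Koszul sign
   of the order in which the variables occur in [e]. A multilinear identity
   between ordinary commutators becomes a super identity once each of its terms
   is wrapped in [SKos]. *)
Inductive sexp :=
| SVar of nat
| SAdd of sexp & sexp
| SMul of sexp & sexp
| SBr of sexp & sexp
| SJo of sexp & sexp
| SScale of int & sexp
| SKos of sexp.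

(** A sum reports the variables of its left summand only; [shomog] demands that the right one has
    the same variables up to order, hence the same parity. *)
Fixpoint svars (e : sexp) : seq nat :=
  match e with
  | SVar i => [:: i]
  | SAdd e _ | SScale _ e | SKos e => svars e
  | SMul e f | SBr e f | SJo e f => svars e ++ svars f
  end.

Fixpoint shomog (e : sexp) : bool :=
  match e with
  | SVar i => true
  | SAdd e f => [&& perm_eq (svars e) (svars f), shomog e & shomog f]
  | SScale _ e | SKos e => shomog e
  | SMul e f | SBr e f | SJo e f => shomog e && shomog f
  end.

Definition is_sbr (e : sexp) := if e is SBr _ _ then true else false.

(* If the expressions in [base] take values in L_j, then an expression accepted
   by [sdeep base d] takes values in L_(j + d). *)
Fixpoint sdeep (base : sexp -> bool) (d : nat) (e : sexp) : bool :=
  (d == 0%N) && base e ||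
  match e with
  | SAdd e f => sdeep base d e && sdeep base d f
  | SScale _ e | SKos e => sdeep base d e
  | SBr e f => sdeep base d.-1 f || is_sbr e && sdeep base d.-2 f
  | _ => false
  end.

(** If [base] takes values in L_j, an accepted expression is a combination of elements of L_(j+3)
    and of brackets [e, x] with e [good] and x in L_(j+1). *)
Fixpoint sreducible (base good : sexp -> bool) (e : sexp) : bool :=
  sdeep base 3 e ||
  match e with
  | SAdd e f => sreducible base good e && sreducible base good f
  | SScale _ e | SKos e => sreducible base good e
  | SBr e f => good e && sdeep base 1 f
  | _ => false
  end.

Section Normalization.
Variable P : nat -> bool.

Definition sparity (e : sexp) := odd (count P (svars e)).

(** The parity of the number of inversions between odd variables. *)
Fixpoint koszul (w : seq nat) : bool :=
  if w is i :: w' then (P i && odd (count (fun j => P j && (j < i)%N) w')) (+) koszul w'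
  else false.

Definition zsign (b : bool) : int := if b then -1 else 1.

Definition pscale (z : int) (s : seq (int * seq nat)) :=
  [seq (z * t.1, t.2) | t <- s].

Definition pmul (s t : seq (int * seq nat)) :=
  flatten [seq [seq (x.1 * y.1, x.2 ++ y.2) | y <- t] | x <- s].

Fixpoint snorm (e : sexp) : seq (int * seq nat) :=
  match e with
  | SVar i => [:: (1, [:: i])]
  | SAdd e f => snorm e ++ snorm f
  | SMul e f => pmul (snorm e) (snorm f)
  | SBr e f => pmul (snorm e) (snorm f) ++
      pscale (- zsign (sparity e && sparity f)) (pmul (snorm f) (snorm e))
  | SJo e f => pmul (snorm e) (snorm f) ++
      pscale (zsign (sparity e && sparity f)) (pmul (snorm f) (snorm e))
  | SScale z e => pscale z (snorm e)
  | SKos e => pscale (zsign (koszul (svars e))) (snorm e)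
  end.

Fixpoint pinsert (t : int * seq nat) (s : seq (int * seq nat)) :=
  if s is t' :: s' then
    if t.2 == t'.2 then (t.1 + t'.1, t.2) :: s' else t' :: pinsert t s'
  else [:: t].

(** Once equal monomials are collected, vanishing of all coefficients suffices for the value to be
    zero in every algebra. *)
Definition pnull (s : seq (int * seq nat)) :=
  all (fun t => t.1 == 0) (foldr pinsert [::] s).

End Normalization.

Fixpoint bitseqs k : seq bitseq :=
  if k is k'.+1 then [seq b :: s | b <- [:: false; true], s <- bitseqs k'] else [:: [::]].

Lemma mem_bitseqs k s : size s = k -> s \in bitseqs k.
Proof.
elim: k s => [|k IHk] [|b s] //= [/IHk sk].
by rewrite cats0 mem_cat; case: b; rewrite (map_f _ sk) ?orbT.
Qed.

(** Signs depend only on the parities of the k variables, so an identity is a finite check over the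
    2^k assignments. *)
Definition sidentity k (e : sexp) := all (fun s => pnull (snorm (nth false s) e)) (bitseqs k).

(** * Lower central series of a superalgebra spanned by words *)

(* The words are only required to span [A]: their independence plays no role. *)
Section SuperAlgebra.
Variables (K : fieldType) (A : lalgType K).
Variables (T : finType) (odd_gen : T -> bool) (word : seq T -> A).
Variables (pproj : bool -> A -> A) (dproj : nat -> A -> A).

Definition seq_parity (w : seq T) : bool := odd (count odd_gen w).
Local Notation par := seq_parity.

Hypothesis scalerAr : forall (c : K) (a b : A), a * (c *: b) = c *: (a * b).
Hypothesis word_cat : forall u v, word (u ++ v) = word u * word v.
Hypothesis word_span :
  forall W : set A, subspace W -> (forall w, W (word w)) -> forall a, W a.
Hypothesis pproj_linear :
  forall p c a b, pproj p (c *: a + b) = c *: pproj p a + pproj p b.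
Hypothesis dproj_linear :
  forall d c a b, dproj d (c *: a + b) = c *: dproj d a + dproj d b.
Hypothesis pproj_word : forall p w, pproj p (word w) = if par w == p then word w else 0.
Hypothesis dproj_word : forall d w, dproj d (word w) = if size w == d then word w else 0.

Implicit Types (a b x y : A) (u v w : seq T) (p q : bool).

HB.instance Definition _ p :=
  GRing.isLinear.Build K A A *:%R (pproj p) (pproj_linear p).
HB.instance Definition _ d :=
  GRing.isLinear.Build K A A *:%R (dproj d) (dproj_linear d).

Definition homog p a := pproj p a = a.

Lemma subspace_homog p : subspace (homog p).
Proof. exact: (subspace_eq (pproj_linear p) (g := idfun)). Qed.

Lemma pprojK p q a : pproj p (pproj q a) = if p == q then pproj q a else 0.
Proof.
apply: (word_span (W := [set a | pproj p (pproj q a) = if p == q then pproj q a else 0])).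
  apply: subspace_eq => c x y; first by rewrite !pproj_linear.
  by case: ifP; rewrite ?pproj_linear // scaler0 addr0.
move=> w /=; rewrite pproj_word; case: (eqVneq (par w) q) => [<-|pw].
  by rewrite pproj_word eq_sym.
by rewrite linear0 if_same.
Qed.

Lemma homog_pproj p a : homog p (pproj p a).
Proof. by rewrite /homog pprojK eqxx. Qed.

Lemma pproj_neq p q a : p != q -> homog q a -> pproj p a = 0.
Proof. by move=> /negPf pq <-; rewrite pprojK pq. Qed.

Lemma pprojE a : a = pproj false a + pproj true a.
Proof.
apply: (word_span (W := [set a | a = pproj false a + pproj true a])).
  apply: (subspace_eq (f := idfun)) => // c x y.
  by rewrite !pproj_linear scalerD_ACA.
by move=> w /=; rewrite !pproj_word; case: (par w); rewrite ?addr0 ?add0r.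
Qed.

Lemma homog_word w : homog (par w) (word w).
Proof. by rewrite /homog pproj_word eqxx. Qed.

Lemma par_cat u v : par (u ++ v) = par u (+) par v.
Proof. by rewrite /par count_cat oddD. Qed.

Lemma homogM p q a b : homog p a -> homog q b -> homog (p (+) q) (a * b).
Proof.
move=> <- <-; apply: (word_span (W := [set a | homog (p (+) q) (pproj p a * pproj q b)])).
  apply: (subspace_preim (f := fun a => pproj p a * pproj q b)) (subspace_homog _).
  by move=> c x y; rewrite pproj_linear mulrDl scalerAl.
move=> u /=; rewrite pproj_word; case: eqP => [<-|_]; last first.
  by rewrite mul0r; exact: subspace0 (subspace_homog _).
apply: (word_span (W := [set b | homog (par u (+) q) (word u * pproj q b)])).
  apply: (subspace_preim (f := fun b => word u * pproj q b)) (subspace_homog _).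
  by move=> c x y; rewrite pproj_linear mulrDr scalerAr.
move=> v /=; rewrite pproj_word; case: eqP => [<-|_]; last first.
  by rewrite mulr0; exact: subspace0 (subspace_homog _).
by rewrite -word_cat -par_cat; exact: homog_word.
Qed.

Definition sbr p q a b : A := a * b - (-1) ^+ (p * q)%N * (b * a).

Lemma sbrE p q a b : sbr p q a b = - (-1) ^+ (p * q)%N *: (b * a) + a * b.
Proof.
rewrite /sbr addrC; congr (_ + _); rewrite -signr_odd -[in RHS]signr_odd.
by case: odd; rewrite ?expr1 ?expr0 ?mulN1r ?opprK ?mul1r ?scaleN1r ?scale1r.
Qed.

Lemma homog_sbr p q a b : homog p a -> homog q b -> homog (p (+) q) (sbr p q a b).
Proof.
move=> Pa Pb; rewrite sbrE; apply: (subspace_homog _).2; last exact: homogM.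
by rewrite addbC; exact: homogM.
Qed.

Lemma sbr_linearr p q a c x y :
  sbr p q a (c *: x + y) = c *: sbr p q a x + sbr p q a y.
Proof.
by rewrite !sbrE mulrDr scalerAr mulrDl -scalerAl !scalerDr !scalerA addrACA (mulrC c).
Qed.

Lemma sbr_linearl p q b c x y :
  sbr p q (c *: x + y) b = c *: sbr p q x b + sbr p q y b.
Proof.
by rewrite !sbrE mulrDr scalerAr mulrDl -scalerAl !scalerDr !scalerA addrACA (mulrC c).
Qed.

Lemma sbrr0 p q a : sbr p q a 0 = 0.
Proof. by rewrite /sbr mul0r !mulr0 subrr. Qed.

Lemma sbr0r p q b : sbr p q 0 b = 0.
Proof. by rewrite /sbr mul0r !mulr0 subrr. Qed.

(* The super commutator of a word with an element that need not be homogeneous. *)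
Definition wcomm w b : A :=
  sbr (par w) false (word w) (pproj false b) + sbr (par w) true (word w) (pproj true b).

Lemma wcomm_linear w c x y : wcomm w (c *: x + y) = c *: wcomm w x + wcomm w y.
Proof. by rewrite /wcomm !pproj_linear !sbr_linearr scalerD_ACA. Qed.

HB.instance Definition _ w :=
  GRing.isLinear.Build K A A *:%R (wcomm w) (wcomm_linear w).

Lemma wcommE w q b : homog q b -> wcomm w b = sbr (par w) q (word w) b.
Proof.
move=> Pb; rewrite /wcomm; case: q Pb => Pb.
  by rewrite (@pproj_neq false _ _ _ Pb) // sbrr0 add0r Pb.
by rewrite (@pproj_neq true _ _ _ Pb) // sbrr0 addr0 Pb.
Qed.

(** The counterparts of [scomm_space] and [lcs], with homogeneity expressed by the projections
    instead of supports; [lcsE] identifies the two series. *)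
Definition sbr_space (X : set A) : set A :=
  lin_span [set c | exists (p q : bool) (a b : A),
    [/\ homog p a, homog q b, X b & c = sbr p q a b]].

Fixpoint L (i : nat) : set A :=
  match i with
  | 0 | 1 => setT
  | (_.+1 as j).+1 => sbr_space (L j)
  end.
Arguments L : simpl never.

Lemma LS k : (0 < k)%N -> L k.+1 = sbr_space (L k).
Proof. by case: k. Qed.

Lemma subspace_L k : subspace (L k).
Proof. by case: k => [|[|k]]; [split|split|exact: subspace_lin_span]. Qed.

Lemma L_sbr k p q a b : (0 < k)%N -> homog p a -> homog q b -> L k b ->
  L k.+1 (sbr p q a b).
Proof.
by move=> k0 Pa Pb Lb; rewrite LS //; apply: lin_span_gen; exists p, q, a, b.
Qed.

(** A bracket of homogeneous elements is homogeneous, so a parity projection either fixes it or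
    kills it. *)
Lemma L_pproj k p a : L k a -> L k (pproj p a).
Proof.
case: k => [|k]//; have [->//|k0] := posnP k.
move: a; rewrite {1}LS //.
apply: (lin_span_sub (W := [set a | L k.+1 (pproj p a)])) => [|_ [q [r [x [y [Px Py Ly ->]]]]]].
  exact: subspace_preim (pproj_linear p) (subspace_L _).
rewrite /=; have Pxy := homog_sbr Px Py.
have [->|pqr] := eqVneq p (q (+) r); first by rewrite Pxy; exact: L_sbr.
by rewrite (pproj_neq pqr Pxy); exact: (subspace0 (subspace_L _)).
Qed.

Lemma L_wcomm k w b : (0 < k)%N -> L k b -> L k.+1 (wcomm w b).
Proof.
move=> k0 Lb; apply: (subspaceD (subspace_L _)).
  by apply: L_sbr => //; [exact: homog_word|exact: homog_pproj|exact: L_pproj].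
by apply: L_sbr => //; [exact: homog_word|exact: homog_pproj|exact: L_pproj].
Qed.

(** A homogeneous left argument is a combination of words of its own parity, so brackets with words
    span L_(k+1). *)
Lemma L_ind k (W : set A) : (0 < k)%N -> subspace W ->
  (forall w b, L k b -> W (wcomm w b)) -> L k.+1 `<=` W.
Proof.
move=> k0 sW Ww; rewrite LS //; apply: lin_span_sub => // _ [p [q [a [b [Pa Pb Lb ->]]]]].
rewrite -Pa.
apply: (word_span (W := [set x | W (sbr p q (pproj p x) b)])) => [|w /=].
  apply: (subspace_preim (f := fun x => sbr p q (pproj p x) b)) => // c x y.
  by rewrite pproj_linear sbr_linearl.
rewrite pproj_word; case: eqP => [<-|_]; last by rewrite sbr0r; exact: (subspace0 sW).
by rewrite -(wcommE w Pb); exact: Ww.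
Qed.

Lemma L_hind k (W : set A) : (0 < k)%N -> subspace W ->
  (forall w q b, L k b -> homog q b -> W (sbr (par w) q (word w) b)) -> L k.+1 `<=` W.
Proof.
move=> k0 sW Ww; apply: L_ind => // w b Lb.
by apply: (subspaceD sW); apply: Ww; solve [exact: L_pproj|exact: homog_pproj].
Qed.

Lemma L_sub k : L k.+1 `<=` L k.
Proof.
elim: k => [|k IHk]//; have [->//|k0] := posnP k.
by apply: L_ind => // [|w b /IHk Lb]; [exact: subspace_L|exact: L_wcomm].
Qed.

Lemma L_leq j k : (j <= k)%N -> L k `<=` L j.
Proof.
elim: k => [|k IHk]; first by rewrite leqn0 => /eqP->.
by rewrite leq_eqVlt => /predU1P[->//|/IHk jk x /L_sub /jk].
Qed.

(** * Degree grading of the lower central series *)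

Lemma pproj_dproj p d a : pproj p (dproj d a) = dproj d (pproj p a).
Proof.
apply: (word_span (W := [set a | pproj p (dproj d a) = dproj d (pproj p a)])).
  by apply: subspace_eq => c x y; rewrite !(pproj_linear, dproj_linear).
move=> w /=; rewrite pproj_word dproj_word.
by case: ifP => dw; case: ifP => pw; rewrite ?linear0 ?pproj_word ?dproj_word ?pw ?dw.
Qed.

Lemma dproj_wordM d w a :
  dproj d (word w * a) = if (size w <= d)%N then word w * dproj (d - size w) a else 0.
Proof.
apply: (word_span (W := [set a | dproj d (word w * a) =
  if (size w <= d)%N then word w * dproj (d - size w) a else 0])) => [|v /=].
  apply: subspace_eq => c x y.
    by rewrite mulrDr scalerAr dproj_linear.
  by case: ifP => _; rewrite ?scaler0 ?addr0 // dproj_linear mulrDr scalerAr.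
rewrite -word_cat !dproj_word size_cat; case: leqP => wd.
  by rewrite -(eqn_add2l (size w) _ (d - _)) subnKC //; case: eqP; rewrite ?mulr0 -?word_cat.
by rewrite gtn_eqF // (leq_trans wd) // leq_addr.
Qed.

Lemma dproj_Mword d w a :
  dproj d (a * word w) = if (size w <= d)%N then dproj (d - size w) a * word w else 0.
Proof.
apply: (word_span (W := [set a | dproj d (a * word w) =
  if (size w <= d)%N then dproj (d - size w) a * word w else 0])) => [|v /=].
  apply: subspace_eq => c x y.
    by rewrite mulrDl -scalerAl dproj_linear.
  by case: ifP => _; rewrite ?scaler0 ?addr0 // dproj_linear mulrDl scalerAl.
rewrite -word_cat !dproj_word size_cat; case: leqP => wd.
  by rewrite -(eqn_add2r (size w) _ (d - _)) subnK //; case: eqP; rewrite ?mul0r -?word_cat.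
by rewrite gtn_eqF // (leq_trans wd) // leq_addl.
Qed.

Lemma dproj_wcomm d w a :
  dproj d (wcomm w a) = if (size w <= d)%N then wcomm w (dproj (d - size w) a) else 0.
Proof.
have dprojD x y : dproj d (x + y) = dproj d x + dproj d y by exact: raddfD.
rewrite /wcomm dprojD !sbrE !dproj_linear !dproj_wordM !dproj_Mword.
by case: ifP => _; rewrite ?scaler0 ?addr0 // !pproj_dproj.
Qed.

Lemma L_dproj k d a : L k a -> L k (dproj d a).
Proof.
elim: k d a => [|k IHk]// d a; have [->//|k0] := posnP k.
move: a; apply: (L_ind k0 (W := [set a | L k.+1 (dproj d a)])) => [|w b Lb /=].
  exact: subspace_preim (dproj_linear d) (subspace_L _).
rewrite dproj_wcomm; case: ifP => _; last exact: (subspace0 (subspace_L _)).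
by apply: L_wcomm => //; exact: IHk.
Qed.

(** * Evaluation of formal super identities *)

Section Evaluation.
Variables (P : nat -> bool) (env : nat -> A).

Fixpoint seval (e : sexp) : A :=
  match e with
  | SVar i => env i
  | SAdd e f => seval e + seval f
  | SMul e f => seval e * seval f
  | SBr e f => sbr (sparity P e) (sparity P f) (seval e) (seval f)
  | SJo e f => seval e * seval f +
      (-1) ^+ (sparity P e * sparity P f)%N * (seval f * seval e)
  | SScale z e => seval e *~ z
  | SKos e => seval e *~ zsign (koszul P (svars e))
  end.

Definition peval (s : seq (int * seq nat)) : A :=
  \sum_(t <- s) (\prod_(i <- t.2) env i) *~ t.1.

Lemma peval_scale z s : peval (pscale z s) = peval s *~ z.
Proof.
rewrite /peval big_map mulrz_suml; apply: eq_bigr => t _ /=.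
by rewrite mulrzA_C.
Qed.

Lemma peval_mul s t : peval (pmul s t) = peval s * peval t.
Proof.
rewrite /peval /pmul big_flatten big_map mulr_suml; apply: eq_bigr => x _.
rewrite big_map mulr_sumr; apply: eq_bigr => y _ /=.
by rewrite big_cat /= mulrzAl mulrzAr mulrzA_C.
Qed.

Lemma zsignE (b : bool) a : a *~ zsign b = (-1) ^+ b * a.
Proof. by case: b; rewrite ?mulrN1z ?mulN1r ?mul1r. Qed.

Lemma snormE e : peval (snorm P e) = seval e.
Proof.
elim: e => /= [i|e IHe f IHf|e IHe f IHf|e IHe f IHf|e IHe f IHf|z e IHe|e IHe].
- by rewrite /peval big_seq1 big_seq1.
- by rewrite /peval big_cat; congr (_ + _).
- by rewrite peval_mul IHe IHf.
- rewrite /peval big_cat; congr (_ + _); rewrite -/(peval _).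
    by rewrite peval_mul IHe IHf.
  by rewrite peval_scale peval_mul IHe IHf mulrNz zsignE mulnb.
- rewrite /peval big_cat; congr (_ + _); rewrite -/(peval _).
    by rewrite peval_mul IHe IHf.
  by rewrite peval_scale peval_mul IHe IHf zsignE mulnb.
- by rewrite peval_scale IHe.
- by rewrite peval_scale IHe.
Qed.

Lemma pnull_peval s : pnull s -> peval s = 0.
Proof.
have ins t s' : peval (pinsert t s') = peval (t :: s').
  elim: s' => [|t' s' IHs] //=; case: eqP => tt'; rewrite /peval !big_cons.
    by rewrite tt' mulrzDr addrA.
  by rewrite -!/(peval _) IHs /peval big_cons addrCA.
have -> : peval s = peval (foldr pinsert [::] s).
  by elim: s => //= t s IHs; rewrite ins /peval !big_cons -!/(peval _) IHs.
rewrite /pnull /peval; elim: (foldr _ _ _) => [|t s' IHs] /=; first by rewrite big_nil.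
by case/andP=> /eqP t0 /IHs; rewrite big_cons t0 mulr0z add0r.
Qed.

Hypothesis env_homog : forall i, homog (P i) (env i).

Lemma homog_seval e : shomog e -> homog (sparity P e) (seval e).
Proof.
rewrite /sparity.
elim: e => /= [i|e IHe f IHf|e IHe f IHf|e IHe f IHf|e IHe f IHf|z e IHe|e IHe].
- by rewrite addn0 oddb.
- case/and3P=> /permP ef he hf; apply: (subspaceD (subspace_homog _)); first exact: IHe.
  by rewrite ef; exact: IHf.
- by case/andP=> he hf; rewrite count_cat oddD; apply: homogM; [exact: IHe|exact: IHf].
- by case/andP=> he hf; rewrite count_cat oddD; apply: homog_sbr; [exact: IHe|exact: IHf].
- case/andP=> /IHe he /IHf hf; rewrite count_cat oddD.
  apply: (subspaceD (subspace_homog _)); first exact: homogM.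
  rewrite mulnb -zsignE; apply: (subspaceMz (subspace_homog _)).
  by rewrite addbC; exact: homogM.
- by move=> he; apply: (subspaceMz (subspace_homog _)); exact: IHe.
- by move=> he; apply: (subspaceMz (subspace_homog _)); exact: IHe.
Qed.

End Evaluation.

Lemma sidentityP (env : seq A) (P : bitseq) k e : size P = k -> sidentity k e ->
  seval (nth false P) (nth 0 env) e = 0.
Proof.
move=> /mem_bitseqs Pk /allP/(_ P Pk) null_e.
by rewrite -snormE; exact: pnull_peval.
Qed.

Lemma homog0 p : homog p 0. Proof. exact: linear0. Qed.

(** Environments are lists with default value 0, which is homogeneous of either parity, so
    homogeneity holds at every index. *)
Lemma homog_nil i : homog (nth false [::] i) (nth 0 [::] i).
Proof. by rewrite !nth_nil; exact: homog0. Qed.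

Lemma homog_cons p a (P : bitseq) (env : seq A) :
  homog p a -> (forall i, homog (nth false P i) (nth 0 env i)) ->
  forall i, homog (nth false (p :: P) i) (nth 0 (a :: env) i).
Proof. by move=> ? ? []. Qed.

(** By the super Jacobi identity, [[a,b],c] is [a,[b,c]] up to a signed [b,[a,c]], and both terms
    have c under two brackets. *)
Lemma L_jacobi k p q r a b c : (0 < k)%N ->
  homog p a -> homog q b -> homog r c -> L k c ->
  L k.+2 (sbr (p (+) q) r (sbr p q a b) c).
Proof.
move=> k0 Ha Hb Hc Lc.
pose e := SAdd (SBr (SBr (SVar 0) (SVar 1)) (SVar 2))
  (SScale (-1) (SAdd (SBr (SVar 0) (SBr (SVar 1) (SVar 2)))
   (SScale (-1) (SKos (SBr (SVar 1) (SBr (SVar 0) (SVar 2))))))).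
have := @sidentityP [:: a; b; c] [:: p; q; r] 3 e erefl.
move=> /(_ (ltac:(by vm_compute))) /=.
rewrite /sparity /= !(oddD, oddb) /= !addbF => /eqP; rewrite addr_eq0 => /eqP->.
have LL p' q' a' b' : homog p' a' -> homog q' b' ->
    L k.+2 (sbr p' (q' (+) r) a' (sbr q' r b' c)).
  by move=> Ha' Hb'; apply: L_sbr => //; [exact: homog_sbr|exact: L_sbr].
rewrite !mulrN1z opprK; apply: (subspaceB (subspace_L _)); first exact: LL.
by apply: (subspaceMz (subspace_L _)); exact: LL.
Qed.

Section Membership.
Variables (P : nat -> bool) (env : nat -> A) (base : sexp -> bool) (j : nat).
Hypothesis env_homog : forall i, homog (P i) (env i).
Hypothesis j_gt0 : (0 < j)%N.
Hypothesis base_L : forall e, base e -> L j (seval P env e).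

Lemma sdeep_L d e : shomog e -> sdeep base d e -> L (j + d) (seval P env e).
Proof.
elim: e d => [i|e IHe f IHf|e IHe f IHf|e IHe f IHf|e IHe f IHf|z e IHe|e IHe] d;
  rewrite [sdeep _ _ _]/= => he /orP[/andP[/eqP-> /base_L]|]; rewrite ?addn0 //.
- case/and3P: he => _ he hf /andP[/(IHe _ he) Le /(IHf _ hf) Lf].
  exact: (subspaceD (subspace_L _)).
- case/andP: he => he hf /orP[/(IHf _ hf) Lf|/andP[ebr /(IHf _ hf) Lf]].
    (* Predecessors are truncated at 0; for small d more depth is obtained than required, and
       [L_leq] absorbs it. *)
    apply: (@L_leq _ (j + d.-1).+1); first by case: (d) => // d'; rewrite addnS.
    by apply: L_sbr; rewrite ?addn_gt0 ?j_gt0 //; exact: homog_seval.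
  apply: (@L_leq _ (j + d.-2).+2).
    by rewrite -addn2 -addnA leq_add2l; case: (d) => [|[|d']]; rewrite ?addn2.
  case: e ebr he {IHe} => // e1 e2 _ /= /andP[h1 h2].
  rewrite /sparity /= count_cat oddD.
  by apply: L_jacobi; rewrite ?addn_gt0 ?j_gt0 //; exact: homog_seval.
- by move/(IHe _ he); exact: (subspaceMz (subspace_L _)).
- by move/(IHe _ he); exact: (subspaceMz (subspace_L _)).
Qed.

Variables (good : sexp -> bool) (W : set A).
Hypotheses (sW : subspace W) (LW : L j.+3 `<=` W).
Hypothesis good_W : forall e q x, good e -> homog q x -> L j.+1 x ->
  W (sbr (sparity P e) q (seval P env e) x).

Arguments sdeep : simpl never.

Lemma sreducible_in e : shomog e -> sreducible base good e -> W (seval P env e).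
Proof.
elim: e => [i|e IHe f IHf|e IHe f IHf|e IHe f IHf|e IHe f IHf|z e IHe|e IHe] he;
  rewrite [sreducible _ _ _]/= => // /orP[/(sdeep_L he)|];
  rewrite ?addn3; try exact: LW.
- case/and3P: he => _ he hf /andP[/(IHe he) We /(IHf hf) Wf].
  exact: (subspaceD sW).
- case/andP: he => he hf /andP[ge /(sdeep_L hf)]; rewrite addn1 => Lf.
  by apply: good_W => //; exact: homog_seval.
- by move/(IHe he); exact: (subspaceMz sW).
- by move/(IHe he); exact: (subspaceMz sW).
Qed.

End Membership.

(** * Generators of the lower central series *)

Hypothesis char0 : [pchar K] =i pred0.

Lemma natK_neq0 i : i.+1%:R != 0 :> K.
Proof. by rewrite ((pcharf0P K).1 char0). Qed.

Lemma subspaceMzK (W : set A) i a : subspace W -> W (a *~ i.+1) -> W a.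
Proof.
by move=> sW; rewrite -pmulrn -scaler_nat; apply: (subspaceZK sW); exact: natK_neq0.
Qed.

(* Twice the polarized cubic identity: the symmetrization of xyz is
   3 (xy + yx) z up to commutators, which [correction] accounts for. *)
Definition cubic_rest : sexp :=
  let g := SVar 3 in let c := SVar 4 in
  let term s := let x := SVar (nth 0 s 0)%N in let y := SVar (nth 0 s 1)%N in
    let z := SVar (nth 0 s 2)%N in
    [:: SScale 3 (SKos (SBr (SMul x y) (SBr (SMul z g) c)));
        SScale 3 (SKos (SBr (SMul x y) (SBr (SMul g z) c)));
        SScale (- 6) (SKos (SBr x (SBr (SMul (SMul y g) z) c)));
        SScale (- 1) (SKos (SBr x (SBr y (SBr z (SBr g c)))));
        SScale 3 (SKos (SBr x (SBr y (SBr g (SBr z c)))))] in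
  let x := SVar 0 in let y := SVar 1 in let z := SVar 2 in
  let correction e := SScale (- 2) (SKos (SBr e (SBr g c))) in
  foldr SAdd (correction (SBr (SMul y z) x))
    ([:: correction (SBr z (SMul x y)); correction (SBr (SMul x z) y);
         correction (SBr z (SMul y x))] ++
     flatten [seq term s | s <- permutations [:: 0; 1; 2]%N]).

Definition cubic_lhs : sexp :=
  SBr (SMul (SJo (SVar 0) (SVar 1)) (SVar 2)) (SBr (SVar 3) (SVar 4)).

Lemma cubic_identity : sidentity 5 (SAdd (SScale 6 cubic_lhs) (SScale (- 1) cubic_rest)).
Proof. by vm_compute. Qed.

(** Single factors and products of two distinct factors among x, y, z: the corresponding words are
    shorter than xyz. *)
Definition cubic_good (e : sexp) : bool :=
  match e with
  | SVar i => (i < 3)%N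
  | SMul (SVar i) (SVar i') => [&& i < 3, i' < 3 & i != i']%N
  | _ => false
  end.

Lemma cubic_reducible :
  sreducible (fun e => if e is SVar 4 then true else false) cubic_good cubic_rest.
Proof. by vm_compute. Qed.

Lemma cubic_homog : shomog cubic_rest.
Proof. by vm_compute. Qed.

(** An element of L_(j+1) is a combination of brackets [v, c] with c in L_j. The cubic identity then
    leaves only terms in L_(j+3) and brackets with shorter words. *)
Lemma cubic_word j (W : set A) (u1 u2 u3 : seq T) q x :
  (0 < j)%N -> subspace W -> L j.+3 `<=` W ->
  (0 < size u1)%N -> (0 < size u2)%N -> (0 < size u3)%N ->
  (forall v, (size v < size u1 + size u2 + size u3)%N ->
     forall y, L j.+1 y -> W (wcomm v y)) ->
  homog q x -> L j.+1 x ->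
  W (sbr (par u1 (+) par u2 (+) par u3) q
      ((word u1 * word u2 + (-1) ^+ (par u1 * par u2)%N * (word u2 * word u1)) * word u3) x).
Proof.
move=> j0 sW LW u1_gt0 u2_gt0 u3_gt0 IH Hx; set a := _ * word u3.
rewrite -[X in W (sbr _ _ _ X)]Hx => {Hx}.
have lin c y z : sbr (par u1 (+) par u2 (+) par u3) q a (pproj q (c *: y + z)) =
    c *: sbr (par u1 (+) par u2 (+) par u3) q a (pproj q y) +
    sbr (par u1 (+) par u2 (+) par u3) q a (pproj q z).
  by rewrite pproj_linear sbr_linearr.
(* The brackets [v, c] of parity other than [q] are killed by [pproj q]. *)
move: x; apply: (L_hind (W := [set x | W (sbr (par u1 (+) par u2 (+) par u3) q a (pproj q x))])
  j0 (subspace_preim lin sW)) => v r c Lc Hc /=.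
have Hvc := homog_sbr (homog_word v) Hc.
have [->|/pproj_neq/(_ Hvc)->] := eqVneq q (par v (+) r); last first.
  by rewrite sbrr0; exact: subspace0.
rewrite Hvc /a => {a lin Hvc}.
pose P := [:: par u1; par u2; par u3; par v; r].
pose env := [:: word u1; word u2; word u3; word v; c].
have Henv : forall i, homog (nth false P i) (nth 0 env i).
  by do 4!apply: (homog_cons (homog_word _)); apply: homog_cons => // i; exact: homog_nil.
have : W (seval (nth false P) (nth 0 env) cubic_rest).
  apply: (sreducible_in Henv j0 _ sW LW _ cubic_homog cubic_reducible).
    by case=> // -[|[|[|[|[]]]]].
  move=> e s y; case: e => // [i|[i| | | | | |] // [i'| | | | | |] //] /=.
    move=> i3 Hs Ly; have -> : sparity (nth false P) (SVar i) = nth false P i.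
      by rewrite /sparity /= addn0 oddb.
    case: i i3 => [|[|[|]]] //= _; rewrite -wcommE //; apply: IH => //.
    - by rewrite -addnA -[ltnLHS]addn0 ltn_add2l addn_gt0 u2_gt0.
    - by rewrite -addnA addnCA -[ltnLHS]addn0 ltn_add2l addn_gt0 u1_gt0.
    - by rewrite -[ltnLHS]add0n ltn_add2r addn_gt0 u1_gt0.
  case/and3P=> i3 i3' ii' Hs Ly.
  have -> : sparity (nth false P) (SMul (SVar i) (SVar i')) = nth false P i (+) nth false P i'.
    by rewrite /sparity /= addn0 oddD !oddb.
  case: i i3 ii' => [|[|[|]]] //= _; case: i' i3' => [|[|[|]]] //= _ _;
    rewrite -word_cat -par_cat -wcommE //; apply: IH => //; rewrite size_cat.
  - by rewrite -[ltnLHS]addn0 ltn_add2l.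
  - by rewrite -addnA ltn_add2l -[ltnLHS]add0n ltn_add2r.
  - by rewrite addnC -[ltnLHS]addn0 ltn_add2l.
  - by rewrite -addnA -[ltnLHS]add0n ltn_add2r.
  - by rewrite addnC -addnA ltn_add2l -[ltnLHS]add0n ltn_add2r.
  - by rewrite addnC -addnA -[ltnLHS]add0n ltn_add2r.
(* The identity gives 6 times the required element, and 6 is invertible in characteristic 0. *)
have /= := @sidentityP env P _ _ erefl cubic_identity.
rewrite mulrN1z => /subr0_eq <- /(subspaceMzK sW).
rewrite /sparity /= !(oddD, oddb) /= !addbF !addbA.
by [].
Qed.

(* Modulo commutators and the elements (xy + yx) z, the word abcd changes sign
   under adjacent transpositions and is invariant under the 4-cycle, which is an
   odd permutation; hence 2 abcd vanishes. *)
Definition quartic_rest : sexp :=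
  let a := SVar 0 in let b := SVar 1 in let c := SVar 2 in let d := SVar 3 in
  let term z e := SScale z (SKos (SBr e (SBr (SVar 4) (SVar 5)))) in
  foldr SAdd (term 1 (SMul (SJo a b) (SMul c d)))
    [:: term (- 1) (SMul (SJo a c) (SMul d b));
        term 1 (SMul (SJo a d) (SMul b c));
        term 1 (SBr (SMul (SMul a c) d) b);
        term 1 (SBr (SMul (SMul c a) d) b);
        term (- 1) (SBr (SMul a d) (SMul b c));
        term (- 1) (SBr d (SMul (SMul a b) c))].

Definition quartic_lhs : sexp :=
  SBr (SMul (SVar 0) (SMul (SVar 1) (SMul (SVar 2) (SVar 3)))) (SBr (SVar 4) (SVar 5)).

(** The three products (ab + ba)cd, (ac + ca)db and (ad + da)bc, with super signs. *)
Definition quartic_good (e : sexp) : bool :=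
  if e is SMul (SJo (SVar 0) (SVar i)) (SMul (SVar i') (SVar i'')) then
    [:: i; i'; i''] \in [:: [:: 1; 2; 3]; [:: 2; 3; 1]; [:: 3; 1; 2]]%N
  else false.

Lemma quartic_identity : sidentity 6 (SAdd (SScale 2 quartic_lhs) (SScale (- 1) quartic_rest)).
Proof. by vm_compute. Qed.

Lemma quartic_reducible :
  sreducible (fun e => if e is SVar 5 then true else false) quartic_good quartic_rest.
Proof. by vm_compute. Qed.

Lemma quartic_homog : shomog quartic_rest.
Proof. by vm_compute. Qed.

(** Strong induction on the length of the word. A word of length at least 4 is cut into four
    factors, and the quartic identity trades it for symmetrized products of the same length, which
    [cubic_word] reduces. The bound on k makes the right argument itself a combination of
    brackets. *)
Lemma wcomm_reduction k (W : set A) :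
  (1 < k)%N -> subspace W -> L k.+2 `<=` W ->
  (forall w x, (size w <= 3)%N -> L k x -> W (wcomm w x)) -> L k.+1 `<=` W.
Proof.
case: k => [|[|j]] // _ sW LW Wshort; apply: L_ind => // w.
elim: (size w).+1 {-2}w (ltnSn (size w)) => // N IH {}w; rewrite ltnS => wN x.
case: (leqP (size w) 3) => [w3|]; first exact: Wshort.
case: w wN => [|a [|b [|c [|d w]]]] //; set w' := d :: w => wN _; move: x.
apply: (L_hind (W := [set x | W (wcomm [:: a, b, c & w'] x)]) (ltn0Sn j)
  (subspace_preim (wcomm_linear _) sW)) => v r y Ly Hy /=.
rewrite (wcommE _ (homog_sbr (homog_word v) Hy)).
pose P := [:: par [:: a]; par [:: b]; par [:: c]; par w'; par v; r].
pose env := [:: word [:: a]; word [:: b]; word [:: c]; word w'; word v; y].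
have Henv : forall i, homog (nth false P i) (nth 0 env i).
  by do 5!apply: (homog_cons (homog_word _)); apply: homog_cons => // i; exact: homog_nil.
have : W (seval (nth false P) (nth 0 env) quartic_rest).
  apply: (sreducible_in Henv (ltn0Sn j) _ sW LW _ quartic_homog quartic_reducible).
    by case=> // -[|[|[|[|[|[]]]]]].
  move=> e s z ge Hs Lz.
  have cubic u1 u2 u3 : size ([:: a, b, c & w']) = (size u1 + size u2 + size u3)%N ->
      (0 < size u1)%N -> (0 < size u2)%N -> (0 < size u3)%N ->
    W (sbr (par u1 (+) par u2 (+) par u3) s
      ((word u1 * word u2 + (-1) ^+ (par u1 * par u2)%N * (word u2 * word u1)) * word u3) z).
    move=> szE h1 h2 h3; apply: (cubic_word (ltn0Sn j) sW LW) => // u; rewrite -szE => uN.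
    by apply: IH; exact: leq_trans uN wN.
  move: e ge => [//|//|[//|//|//|//|[[|//]|//|//|//|//|//|//] [i|//|//|//|//|//|//]|//|//]
     [//|//|[i'|//|//|//|//|//|//] [i''|//|//|//|//|//|//]|//|//|//|//]|//|//|//|//] /=.
  (* In each case the last two factors are merged into one word, leaving three nonempty words. *)
  rewrite !inE => /or3P[] /eqP[-> -> ->] /=; rewrite /sparity /= !(oddD, oddb) /= !addbF.
  - by rewrite -(par_cat [:: c] w') -(word_cat [:: c]) addbA; exact: cubic.
  - rewrite -(par_cat w' [:: b]) -(word_cat w') addbA; apply: cubic => //.
    by rewrite size_cat !addn1.
  - rewrite -(par_cat [:: b] [:: c]) -(word_cat [:: b]) addbA; apply: cubic => //.
    by rewrite addn2.
have /= := @sidentityP env P _ _ erefl quartic_identity.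
rewrite mulrN1z => /subr0_eq <- /(subspaceMzK sW).
rewrite -!word_cat /sparity /= !(oddD, oddb) /= !addbF.
by rewrite -(par_cat [:: c] w') -(par_cat [:: b]) -(par_cat [:: a]).
Qed.

(** * Growth of B_2 *)

(** Generated by left multiples; [M3_mulr] shows that the ideal is two-sided. *)
Definition M3 : set A := lin_span [set y | exists a z, L 3 z /\ y = a * z].

Lemma subspace_M3 : subspace M3. Proof. exact: subspace_lin_span. Qed.

Lemma L3_M3 : L 3 `<=` M3.
Proof. by move=> z Lz; apply: lin_span_gen; exists 1, z; rewrite mul1r. Qed.

Lemma mull_linear a c y z : a * (c *: y + z) = c *: (a * y) + a * z.
Proof. by rewrite mulrDr scalerAr. Qed.

Lemma mulr_linear a c y z : (c *: y + z) * a = c *: (y * a) + z * a.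
Proof. by rewrite mulrDl scalerAl. Qed.

Lemma M3_mull a y : M3 y -> M3 (a * y).
Proof.
apply: (lin_span_sub (subspace_preim (mull_linear a) subspace_M3)) => _ [b [z [Lz ->]]] /=.
by rewrite mulrA; apply: lin_span_gen; exists (a * b), z.
Qed.

Lemma M3_mulr a y : M3 y -> M3 (y * a).
Proof.
apply: (lin_span_sub (subspace_preim (mulr_linear a) subspace_M3)) => _ [b [z [Lz ->]]] /=.
rewrite -mulrA; apply: M3_mull.
apply: (word_span (subspace_preim (mull_linear z) subspace_M3)) => w /=.
suff Mw q : M3 (pproj q z * word w).
  by rewrite (pprojE z) mulrDl; exact: (subspaceD subspace_M3).
have Lq : L 3 (pproj q z) by exact: L_pproj.
(* Up to sign zw is wz - [w,z], and the bracket lies in L_4, hence in L_3. *)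
have : L 3 (sbr (par w) q (word w) (pproj q z)).
  by apply/L_sub/L_sbr => //; [exact: homog_word|exact: homog_pproj].
rewrite sbrE => /L3_M3 /(subspaceB subspace_M3).
move/(_ _ (M3_mull (word w) (L3_M3 Lq))); rewrite addrK.
by apply: (subspaceZK subspace_M3); rewrite oppr_eq0 signr_eq0.
Qed.

Lemma L3_words (W : set A) : subspace W ->
  (forall u v w, W (sbr (par u) (par v (+) par w) (word u)
     (sbr (par v) (par w) (word v) (word w)))) -> L 3 `<=` W.
Proof.
move=> sW Ww; apply: L_ind => // u.
apply: (L_ind _ (subspace_preim (wcomm_linear u) sW)) => //= v b _.
move: b; apply: (word_span (W := [set b | W (wcomm u (wcomm v b))])).
  by apply: (subspace_preim (f := wcomm u \o wcomm v)) => // c x y; rewrite /= !wcomm_linear.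
move=> w /=; rewrite (wcommE v (homog_word w)).
rewrite (wcommE u (homog_sbr (homog_word v) (homog_word w))).
exact: Ww.
Qed.

(* [a, b [c,[d,e]]] written as an element of L_3, whence [A, M_3] is in L_3. *)
Definition ideal_rest : sexp :=
  let a := SVar 0 in let b := SVar 1 in let c := SVar 2 in
  let d := SVar 3 in let e := SVar 4 in
  foldr SAdd (SKos (SBr a (SBr c (SMul b (SBr d e)))))
    [:: SKos (SBr c (SBr b (SMul (SBr d e) a)));
        SKos (SBr e (SBr d (SMul a (SBr b c))));
        SKos (SBr d (SBr e (SMul a (SBr c b))));
        SScale (- 1) (SKos (SBr b (SBr c (SMul (SBr d e) a))))].

Lemma ideal_identity : sidentity 5 (SAdd (SBr (SVar 0) (SMul (SVar 1)
  (SBr (SVar 2) (SBr (SVar 3) (SVar 4))))) (SScale (- 1) ideal_rest)).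
Proof. by vm_compute. Qed.

Lemma ideal_deep : shomog ideal_rest && sdeep xpredT 2 ideal_rest.
Proof. by vm_compute. Qed.

Lemma wcomm_M3 w y : M3 y -> L 3 (wcomm w y).
Proof.
apply: (lin_span_sub (subspace_preim (wcomm_linear w) (subspace_L 3))).
move=> _ [a [z [Lz ->]]] /=; move: a.
apply: (word_span (W := [set a | L 3 (wcomm w (a * z))])).
  apply: (subspace_preim (f := fun a => wcomm w (a * z))) (subspace_L 3) => c x t.
  by rewrite mulr_linear wcomm_linear.
move=> u /=; move: z Lz; apply: (L3_words (W := [set z | L 3 (wcomm w (word u * z))])).
  apply: (subspace_preim (f := fun z => wcomm w (word u * z))) (subspace_L 3) => c x t.
  by rewrite mull_linear wcomm_linear.
move=> v1 v2 v3 /=.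
have Hz := homog_sbr (homog_word v1) (homog_sbr (homog_word v2) (homog_word v3)).
rewrite (wcommE w (homogM (homog_word u) Hz)).
pose P := [:: par w; par u; par v1; par v2; par v3].
pose env := [:: word w; word u; word v1; word v2; word v3].
have Henv : forall i, homog (nth false P i) (nth 0 env i).
  by do 5!apply: (homog_cons (homog_word _)); exact: homog_nil.
have /andP[he de] := ideal_deep.
(* Here j = 1 and L_1 = A, so every expression is admissible as a base and two brackets suffice to
   reach L_3. *)
have := sdeep_L Henv (ltn0Sn 0) (fun _ _ => I) he de.
have /= := @sidentityP env P _ _ erefl ideal_identity.
rewrite mulrN1z => /subr0_eq <-.
by rewrite /sparity /= !(oddD, oddb) /= !addbF.
Qed.

Lemma M3_zsign (b : bool) y : M3 (y *~ zsign b) <-> M3 y.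
Proof.
split; last exact: (subspaceMz subspace_M3).
by case: b => //=; rewrite mulrN1z => /(subspaceN subspace_M3); rewrite opprK.
Qed.

Definition gcomm (x y : T) : A :=
  sbr (par [:: x]) (par [:: y]) (word [:: x]) (word [:: y]).

Lemma gcommC (x y : T) : gcomm y x = - (gcomm x y *~ zsign (par [:: x] && par [:: y])).
Proof.
rewrite zsignE -mulnb /gcomm /sbr mulrBr (mulrA _ _ (_ * _)).
by rewrite -expr2 sqrr_sign mul1r opprB mulnC.
Qed.

(** Expand [a,[xy,b]] by the Leibniz rule: besides the two products it contains x[a,[y,b]],
    [a,[x,b]]y and the commutator of [x,b] with [a,y], all in [M3]. *)
Lemma gcomm_swap (a x y b : T) :
  M3 (gcomm a x * gcomm y b + gcomm a y * gcomm x b *~ zsign (par [:: x] && par [:: y])).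
Proof.
pose P := [:: par [:: a]; par [:: x]; par [:: y]; par [:: b]].
pose env := [:: word [:: a]; word [:: x]; word [:: y]; word [:: b]].
have Henv : forall i, homog (nth false P i) (nth 0 env i).
  by do 4!apply: (homog_cons (homog_word _)); exact: homog_nil.
pose V := SVar.
pose lhs := SAdd (SMul (SBr (V 0) (V 1)) (SBr (V 2) (V 3)))
   (SKos (SMul (SBr (V 0) (V 2)) (SBr (V 1) (V 3))))%N.
pose r1 := SBr (V 0) (SBr (SMul (V 1) (V 2)) (V 3))%N.
pose r2 := SBr (V 0) (SBr (V 2) (V 3))%N.
pose r3 := SBr (V 0) (SBr (V 1) (V 3))%N.
pose r4 := SBr (SBr (V 1) (V 3)) (SBr (V 0) (V 2))%N.
pose rest := foldr SAdd r1 [:: SScale (- 1) (SKos (SMul (V 1) r2));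
  SScale (- 1) (SKos (SMul r3 (V 2))); SScale (- 1) (SKos r4)]%N.
have idE : sidentity 4 (SAdd lhs (SScale (- 1) rest)) by vm_compute.
have L3r r : shomog r -> sdeep xpredT 2 r -> M3 (seval (nth false P) (nth 0 env) r).
  by move=> hr dr; apply/L3_M3/(sdeep_L Henv (ltn0Sn 0) (fun _ _ => I) hr dr).
have : M3 (seval (nth false P) (nth 0 env) rest).
  do 3?apply: (subspaceD subspace_M3); do ?apply: (subspaceMz subspace_M3).
  - by apply: M3_mull; exact: (L3r r2).
  - by apply: M3_mulr; exact: (L3r r3).
  - exact: (L3r r4).
  - exact: (L3r r1).
have /= := @sidentityP env P _ _ erefl idE.
rewrite mulrN1z => /subr0_eq <-.
rewrite /sparity /= !(oddD, oddb) /= ?andbF ?addbF /=.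
by rewrite andbT andbC.
Qed.

(** Consecutive letters are paired into commutators; a last unpaired letter is dropped. *)
Fixpoint cprod (s : seq T) : A := if s is x :: y :: s' then gcomm x y * cprod s' else 1.

(** Within a pair this is super antisymmetry of the commutator; across two pairs it is [gcomm_swap],
    the even length ensuring that the second pair is complete. *)
Lemma cprod_swap s1 (x y : T) s2 : ~~ odd (size (s1 ++ x :: y :: s2)) ->
  M3 (cprod (s1 ++ x :: y :: s2) +
      cprod (s1 ++ y :: x :: s2) *~ zsign (par [:: x] && par [:: y])).
Proof.
elim: (size s1).+1 {-2}s1 (ltnSn (size s1)) => // N IH {}s1; rewrite ltnS.
case: s1 => [|a [|b s1]] /= sN.
- move=> _; rewrite [gcomm y x]gcommC mulNr mulNrz -mulrzAl -mulrzA.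
  suff -> : zsign (par [:: x] && par [:: y]) * zsign (par [:: x] && par [:: y]) = 1.
    by rewrite mulr1z subrr; exact: (subspace0 subspace_M3).
  by case: (_ && _).
- case: s2 {IH} => [//|b s2] _ /=; rewrite !mulrA -mulrzAl -mulrDl.
  by apply: M3_mulr; exact: gcomm_swap.
- rewrite !negbK => se; rewrite -mulrzAr -mulrDr; apply: M3_mull; apply: IH => //.
  exact: leq_trans sN.
Qed.

Definition mon (e s : seq T) : A := word e * cprod s.

(** Swapping x and y produces [x,y], which is super central modulo [M3] and moves past [e2] to join
    the product of commutators. *)
Lemma mon_swap e1 (x y : T) e2 s :
  M3 (mon (e1 ++ x :: y :: e2) s
      - (mon (e1 ++ y :: x :: e2) s *~ zsign (par [:: x] && par [:: y])
         + mon (e1 ++ e2) (x :: y :: s) *~ zsign (par e2 && (par [:: x] (+) par [:: y])))).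
Proof.
set p := par [:: x]; set q := par [:: y]; set r := par e2.
have Hg : homog (p (+) q) (gcomm x y) by apply: homog_sbr; exact: homog_word.
have : M3 (sbr r (p (+) q) (word e2) (gcomm x y)).
  apply: L3_M3; apply: L_sbr => //; first exact: homog_word.
  by apply: L_sbr => //; exact: homog_word.
rewrite -[y :: e2]cat1s -[x :: (_ ++ _)]cat1s -[x :: e2]cat1s -[y :: (_ ++ _)]cat1s.
rewrite /mon !word_cat /= => /(M3_mulr (cprod s)) /(M3_mull (word e1)) M.
have -> : word [:: x] * (word [:: y] * word e2) =
    word [:: y] * (word [:: x] * word e2) *~ zsign (p && q) + gcomm x y * word e2.
  by rewrite zsignE -mulnb /gcomm /sbr mulrBl !mulrA addrC subrK.
rewrite mulrDr mulrDl mulrzAr mulrzAl opprD addrACA subrr add0r.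
rewrite -(M3_zsign (r && (p (+) q))) mulrzBl -mulrzA.
have -> : zsign (r && (p (+) q)) * zsign (r && (p (+) q)) = 1 by case: (_ && _).
rewrite mulr1z -(M3_zsign true) mulrN1z opprB.
suff -> : word e1 * word e2 * (gcomm x y * cprod s) -
    word e1 * (gcomm x y * word e2) * cprod s *~ zsign (r && (p (+) q)) =
    word e1 * (sbr r (p (+) q) (word e2) (gcomm x y) * cprod s) by [].
move: (gcomm x y) => g; rewrite /sbr.
by rewrite mulnb -zsignE mulrBl mulrBr !mulrzAl mulrzAr !mulrA.
Qed.

Definition sorted_seq (f : T -> nat) : seq T := flatten [seq nseq (f x) x | x : T <- enum T].

Lemma count_sorted_seq f (x : T) : count_mem x (sorted_seq f) = f x.
Proof.
rewrite count_flatten -map_comp sumnE big_map big_enum /= (bigD1 x) //=.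
rewrite count_nseq /= eqxx mul1n big1 ?addn0 // => y /negPf yx.
by rewrite count_nseq /= yx.
Qed.

Lemma perm_sorted_seq (s : seq T) : perm_eq s (sorted_seq (fun x : T => count_mem x s)).
Proof. by apply/allP => x _ /=; rewrite count_sorted_seq. Qed.

Lemma size_sorted_seq f : size (sorted_seq f) = (\sum_(x : T) f x)%N.
Proof.
rewrite size_flatten /shape -map_comp sumnE big_map big_enum /=.
by apply: eq_bigr => x _; rewrite size_nseq.
Qed.

Lemma perm_dup (s : seq T) (x : T) : (1 < count_mem x s)%N -> exists s', perm_eq s (x :: x :: s').
Proof.
move=> xs; have x1 : x \in s by rewrite -has_pred1 has_count (ltn_trans _ xs).
have x2 : x \in rem x s.
  rewrite -has_pred1 has_count; move: xs.
  by rewrite (permP (perm_to_rem x1)) /= eqxx.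
exists (rem x (rem x s)); apply: (perm_trans (perm_to_rem x1)).
by rewrite perm_cons; exact: perm_to_rem.
Qed.

Lemma par1 (x : T) : par [:: x] = odd_gen x.
Proof. by rewrite /par /= addn0 oddb. Qed.

(* The bounds on f and g come from 2 x^2 = [x,x] for x odd and, modulo [M3], from
   the antisymmetry of products of commutators for x even. *)
Lemma mon_span (W : set A) d : subspace W -> M3 `<=` W ->
  (forall f g : T -> nat, (forall x : T, odd_gen x -> (f x <= 1)%N) ->
     (forall x : T, ~~ odd_gen x -> (g x <= 1)%N) ->
     (\sum_(x : T) f x + \sum_(x : T) g x)%N = d -> W (mon (sorted_seq f) (sorted_seq g))) ->
  forall e s, ~~ odd (size s) -> (size e + size s)%N = d -> W (mon e s).
Proof.
move=> sW MW Wfam e s; elim: (size e).+1 {-2}e (ltnSn (size e)) s => // N IH {}e.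
rewrite ltnS => eN s se eds.
have low e' s' : (size e' < size e)%N -> ~~ odd (size s') -> (size e' + size s')%N = d ->
    W (mon e' s').
  by move=> e'e; apply: IH; exact: leq_trans e'e eN.
(* Each swap costs a monomial whose word is two letters shorter, covered by the induction
   hypothesis. *)
have eperm e' : perm_eq e e' -> W (mon e' s) -> W (mon e s).
  move=> ee'; pose Q t := size t = size e -> W (mon t s).
  suff Qe : Q e' -> Q e by move=> We'; apply: Qe => // _.
  rewrite perm_sym in ee'; apply: (perm_adjacent_ind (Q := Q)) ee' => s1 x y s2 Qxy szE.
  rewrite -[mon _ s](subrK (mon (s1 ++ x :: y :: s2) s *~ zsign (par [:: y] && par [:: x])
         + mon (s1 ++ s2) (y :: x :: s) *~ zsign (par s2 && (par [:: y] (+) par [:: x])))).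
  apply: (subspaceD sW); first by apply: MW; exact: mon_swap.
  move: szE; rewrite !size_cat /= => szE.
  apply: (subspaceD sW); apply: (subspaceMz sW); first by apply: Qxy; rewrite size_cat.
  apply: low; rewrite /= ?negbK // size_cat -?szE -?addnS ?leq_add2l //.
  by rewrite -eds -szE !addnS !addSn.
have [/existsP[x /andP[ox xe]]|/existsPn e1] :=
    boolP [exists x : T, odd_gen x && (1 < count_mem x e)%N].
  have [e' ee'] := perm_dup xe; apply: (eperm _ ee').
  have szE := perm_size ee'; rewrite /= in szE.
  have := MW _ (mon_swap [::] x x e' s); rewrite /= !par1 ox /= mulrN1z andbF mulr1z.
  rewrite opprD opprK addrA -mulr2n => /(subspaceD sW).
  have /[swap]/[apply] : W (mon e' [:: x, x & s]).
    by apply: low; rewrite /= ?negbK ?szE // -eds szE !addnS !addSn.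
  by rewrite subrK pmulrn => /(subspaceMzK sW).
apply: (eperm _ (perm_sorted_seq e)); set e0 := sorted_seq _.
(* Swaps in the commutator factor only change the sign modulo [M3], so the word is left as it is. *)
have sperm s' : perm_eq s s' -> W (mon e0 s') -> W (mon e0 s).
  move=> ss'; pose Q t := size t = size s -> W (mon e0 t).
  suff Qs : Q s' -> Q s by move=> Ws'; apply: Qs => // _.
  rewrite perm_sym in ss'; apply: (perm_adjacent_ind (Q := Q)) ss' => s1 x y s2 Qxy szE.
  rewrite -[mon e0 _](addrK (mon e0 (s1 ++ x :: y :: s2) *~ zsign (par [:: y] && par [:: x]))).
  apply: (subspaceB sW).
    by apply: MW; rewrite /mon -mulrzAr -mulrDr; apply/M3_mull/cprod_swap; rewrite szE.
  by apply: (subspaceMz sW); apply: Qxy; rewrite -szE !size_cat.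
have [/existsP[x /andP[ox xs]]|/existsPn s1] :=
    boolP [exists x : T, ~~ odd_gen x && (1 < count_mem x s)%N].
  have [s' ss'] := perm_dup xs; apply: (sperm _ ss').
  have szs' : ~~ odd (size ([::] ++ [:: x, x & s'])) by rewrite -(perm_size ss').
  have := MW _ (M3_mull (word e0) (cprod_swap szs')).
  by rewrite !par1 (negPf ox) /= mulr1z -mulr2n mulrnAr pmulrn => /(subspaceMzK sW).
apply: (sperm _ (perm_sorted_seq s)); apply: Wfam.
- by move=> x ox; move: (e1 x); rewrite ox /= -leqNgt.
- by move=> x ox; move: (s1 x); rewrite ox /= -leqNgt.
- rewrite -!size_sorted_seq -(perm_size (perm_sorted_seq e)).
  by rewrite -(perm_size (perm_sorted_seq s)).
Qed.

Lemma word_nil : word [::] = 1.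
Proof.
rewrite -[LHS]mulr1; apply: (word_span (W := [set a | word [::] * a = a])).
  by apply: (subspace_eq (g := idfun)) => // c x y; exact: mull_linear.
by move=> w /=; rewrite -word_cat.
Qed.

(** Up to signs [xw,b] = [x,wb] + [w,bx], which shortens the left argument by one letter. *)
Lemma L2_generators (W : set A) : subspace W ->
  (forall (x : T) b, W (wcomm [:: x] b)) -> L 2 `<=` W.
Proof.
move=> sW Wgen; apply: L_hind => // w; elim: w => [|x w IHw] q b _ Hb.
  by rewrite word_nil /sbr mul1r mulr1 mul0n expr0 mul1r subrr; exact: subspace0.
pose P := [:: par [:: x]; par w; q].
pose env := [:: word [:: x]; word w; b].
have Henv : forall i, homog (nth false P i) (nth 0 env i).
  by do 2!apply: (homog_cons (homog_word _)); apply: homog_cons => // i; exact: homog_nil.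
pose e1 := SKos (SBr (SVar 0) (SMul (SVar 1) (SVar 2))).
pose e2 := SKos (SBr (SVar 1) (SMul (SVar 2) (SVar 0))).
have idE : sidentity 3 (SAdd (SBr (SMul (SVar 0) (SVar 1)) (SVar 2))
  (SScale (- 1) (SAdd e1 e2))) by vm_compute.
have : W (seval (nth false P) (nth 0 env) (SAdd e1 e2)).
  apply: (subspaceD sW); apply: (subspaceMz sW).
    have := homog_seval Henv (e := SMul (SVar 1) (SVar 2)) isT.
    rewrite /sparity /= !(oddD, oddb) /= !addbF => Hs.
    by rewrite -wcommE.
  have := homog_seval Henv (e := SMul (SVar 2) (SVar 0)) isT.
  rewrite /sparity /= !(oddD, oddb) /= !addbF => Hs.
  exact: IHw.
have /= := @sidentityP env P _ _ erefl idE.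
rewrite mulrN1z => /subr0_eq <-.
rewrite /sparity /= !(oddD, oddb) /= !addbF.
by rewrite -word_cat -par_cat.
Qed.

Lemma mon_family d : (0 < #|T|)%N -> exists2 E : seq A,
  (size E <= 2 ^ #|T| * d.+1 ^ #|T|.-1)%N &
  forall w, size w = d -> span_mod E M3 (word w).
Proof.
case/card_gt0P => x0 _.
(* [del] holds the exponents bounded by 1 and [main] the other ones; the exponent
   of x0 is then forced by the degree. *)
pose V (v : {ffun {x : T | x != x0} -> 'I_d.+1}) (x : T) : nat :=
  oapp (fun t => v t : nat) 0%N (insub x).
pose main (del : {ffun T -> bool}) (v : {ffun {x : T | x != x0} -> 'I_d.+1}) (x : T) :=
  if x == x0 then (d - \sum_(t : T) del t - \sum_(t | t != x0) V v t)%N else V v x.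
pose F (i : {ffun T -> bool} * {ffun {x : T | x != x0} -> 'I_d.+1}) (x : T) : nat :=
  if odd_gen x then nat_of_bool (i.1 x) else main i.1 i.2 x.
pose G (i : {ffun T -> bool} * {ffun {x : T | x != x0} -> 'I_d.+1}) (x : T) : nat :=
  if odd_gen x then main i.1 i.2 x else nat_of_bool (i.1 x).
exists [seq mon (sorted_seq (F i)) (sorted_seq (G i)) | i <- enum predT].
  rewrite size_map -cardE card_prod !card_ffun card_bool card_ord card_sig.
  by rewrite -(cardC1 x0).
set E := [seq _ | i <- _] => w wd; have sW := subspace_span_mod E subspace_M3.
have -> : word w = mon w [::] by rewrite /mon mulr1.
apply: (mon_span (W := span_mod E M3) sW _ (d := d)); rewrite ?addn0 //.
  exact: (sub_span_mod _ subspace_M3).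
move=> f g f1 g1 fgd.
(* The parameters are recovered from f and g; [u] is at most d, so storing it in ['I_d.+1] loses
   nothing. *)
pose del := [ffun x : T => if odd_gen x then f x == 1%N else g x == 1%N].
pose u (x : T) := if odd_gen x then g x else f x.
have delE (x : T) : (del x : nat) = if odd_gen x then f x else g x.
  rewrite ffunE; case: (boolP (odd_gen x)) => ox.
    by case: (f x) (f1 _ ox) => [|[]].
  by case: (g x) (g1 _ ox) => [|[]].
have sum_u : (\sum_(x : T) del x + \sum_(x : T) u x)%N = d.
  rewrite -fgd -!big_split; apply: eq_bigr => x _ /=.
  by rewrite delE /u; case: ifP => // _; rewrite addnC.
pose v : {ffun {x : T | x != x0} -> 'I_d.+1} := [ffun t => inord (u (val t))].
have u_le (x : T) : (u x <= d)%N.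
  by rewrite -sum_u; apply: leq_trans (leq_addl _ _); rewrite (bigD1 x) //= leq_addr.
have VE (x : T) : x != x0 -> V v x = u x.
  move=> xx0; rewrite /V insubT /= ffunE /= inordK // ltnS; exact: u_le.
have mainE (x : T) : main del v x = u x.
  rewrite /main; case: eqP => [->|/eqP/VE->//].
  rewrite (eq_bigr u VE) -{1}sum_u addKn.
  by rewrite (bigD1 x0) //= addnK.
apply: span_mod_mem; first exact: subspace_M3.
apply/mapP; exists (del, v); first by rewrite mem_enum.
have sorted_ext (h h' : T -> nat) : h =1 h' -> sorted_seq h = sorted_seq h'.
  move=> hh'; rewrite /sorted_seq (eq_map (g := fun x : T => nseq (h' x) x)) // => x.
  by rewrite hh'.
congr (mon _ _); apply: sorted_ext => x.
  by rewrite /F mainE delE /u /=; case: (odd_gen x).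
by rewrite /G mainE delE /u /=; case: (odd_gen x).
Qed.

(** * Growth of B_k for all k at least 2 *)

Lemma leq_expn i j e : (i <= j)%N -> (i ^ e <= j ^ e)%N.
Proof. by case: e => // e ij; rewrite leq_exp2r. Qed.

(** The factor [#|T|] makes the bound vanish when there are no generators, a case in which the
    exponent m + n - 1 is negative. *)
Definition graded_cover k C := forall d, exists2 E : seq A,
  (size E <= C * #|T| * d.+1 ^ #|T|.-1)%N &
  forall a, L k a -> span_mod E (L k.+1) (dproj d a).

Lemma graded_cover2 : exists C, graded_cover 2 C.
Proof.
exists (2 ^ #|T|)%N => d.
have [T0|T_gt0] := posnP #|T|.
  exists [::]; first by rewrite T0 muln0.
  have sW := subspace_span_mod [::] (subspace_L 3).
  apply: (L2_generators (subspace_preim (dproj_linear d) sW)) => x.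
  by have := fintype0 x T0.
(* Bracketing with a generator raises the degree by 1 and sends [M3] into L_3, so a spanning family
   of A / M_3 in degree d - 1 is enough. *)
have [E0 sE0 E0w] := mon_family d.-1 T_gt0.
exists [seq wcomm [:: x] e | x : T <- enum T, e : A <- E0].
  rewrite size_allpairs -cardE (mulnC (2 ^ _)%N) -mulnA leq_mul2l; apply/orP; right.
  apply: (leq_trans sE0); rewrite leq_mul2l; apply/orP; right.
  by apply: leq_expn; rewrite ltnS leq_pred.
set E := (X in span_mod X _); have sW := subspace_span_mod E (subspace_L 3).
apply: (L2_generators (subspace_preim (dproj_linear d) sW)) => x b /=.
rewrite dproj_wcomm /=; case: ifP => d0; last exact: (subspace0 sW).
rewrite subn1; move: b.
apply: (word_span (W := [set b | span_mod E (L 3) (wcomm [:: x] (dproj d.-1 b))])).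
  apply: (subspace_preim (f := fun b => wcomm [:: x] (dproj d.-1 b)) _ sW) => c a a'.
  by rewrite dproj_linear wcomm_linear.
move=> w /=; rewrite dproj_word; case: eqP => [/E0w|_]; last first.
  by rewrite linear0; exact: (subspace0 sW).
apply: (span_mod_sub (subspace_preim (wcomm_linear _) sW)) => [e eE|y /wcomm_M3 Ly] /=.
  apply: span_mod_mem; first exact: subspace_L.
  by apply/allpairsP; exists (x, e); rewrite mem_enum.
exact: (sub_span_mod _ (subspace_L 3)).
Qed.

(** Brackets with the finitely many words w of length at most 3 carry spanning families of
    B_k[d - |w|] to one of B_(k+1)[d]; their number enters the new constant. *)
Lemma graded_coverS k C : (1 < k)%N -> graded_cover k C -> exists C', graded_cover k.+1 C'.
Proof.
move=> k1 cov.
pose short : seq (seq T) :=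
  flatten [seq [seq tval t | t <- enum {: i.-tuple T}] | i <- iota 0 4].
have shortP w : (size w <= 3)%N -> w \in short.
  move=> w3; apply/flattenP; exists [seq tval t | t <- enum {: (size w).-tuple T}].
    by apply/mapP; exists (size w); rewrite ?mem_iota.
  by apply/mapP; exists (in_tuple w); rewrite ?mem_enum.
have /choice[F FP] : forall d, exists E : seq A, (size E <= C * #|T| * d.+1 ^ #|T|.-1)%N /\
    forall a, L k a -> span_mod E (L k.+1) (dproj d a).
  by move=> d; have [E ? ?] := cov d; exists E.
exists (size short * C)%N => d.
exists (flatten [seq [seq wcomm w e | e <- F (d - size w)%N] | w <- short]).
  have FE w : (size (F (d - size w)) <= C * #|T| * d.+1 ^ #|T|.-1)%N.
    apply: leq_trans (FP _).1 _; rewrite leq_mul2l; apply/orP; right.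
    by apply: leq_expn; rewrite ltnS leq_subr.
  rewrite -!mulnA (mulnA C); elim: short {shortP} => [|w s IHs] //=.
  by rewrite size_cat size_map mulSn leq_add.
set E := (X in span_mod X _); have sW := subspace_span_mod E (subspace_L k.+2).
apply: (wcomm_reduction k1 (subspace_preim (dproj_linear d) sW)) => [u Lu|w x w3 Lx] /=.
  by apply: (sub_span_mod _ (subspace_L _)); exact: L_dproj.
rewrite dproj_wcomm; case: ifP => wd; last exact: (subspace0 sW).
have [_ /(_ x Lx)] := FP (d - size w)%N.
apply: (span_mod_sub (subspace_preim (wcomm_linear _) sW)) => [e eE|y Ly] /=.
  apply: span_mod_mem; first exact: subspace_L.
  apply/flattenP; exists [seq wcomm w e | e <- F (d - size w)%N]; last exact: map_f.
  by apply/mapP; exists w => //; exact: shortP.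
by apply: (sub_span_mod _ (subspace_L _)); apply: L_wcomm.
Qed.

Lemma B_dim_growth k : (1 < k)%N -> exists C, forall d, exists2 N,
  (N <= C * #|T| * d.+1 ^ #|T|.-1)%N &
  has_quot_dim (L k `&` [set a | dproj d a = a]) (L k.+1) N.
Proof.
move=> k1; have [C cov] : exists C, graded_cover k C.
  case: k k1 => [|[|k]] // _; elim: k => [|k [C IHk]]; first exact: graded_cover2.
  exact: (graded_coverS _ IHk).
exists C => d; have [E sE LE] := cov d.
have sU : subspace (L k `&` [set a | dproj d a = a]).
  have sd := subspace_eq (dproj_linear d) (g := idfun) (fun _ _ _ => erefl).
  split=> [|c x y [Lx dx] [Ly dy]]; first by split; [exact: (subspace_L k).1|exact: sd.1].
  by split; [exact: (subspace_L k).2|exact: sd.2].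
have [|N NE quot] := has_quot_dim_le sU (subspace_L k.+1) (E := E).
  by move=> u [Lu <-]; exact: LE.
by exists N => //; exact: leq_trans NE sE.
Qed.

End SuperAlgebra.

(** * Application to the free superalgebra *)

Section FreeSuperalgebra.
Variables (K : fieldType) (m n : nat).
Local Notation gen := ('I_m + 'I_n)%type.
Local Notation A := (free_salg K m n).

Definition free_word (s : seq gen) : A := << FMonom s >>.

Definition free_pproj p : A -> A := restr (fun w : sword m n => word_parity w == p).

Definition free_dproj d : A -> A := restr (fun w : sword m n => fdeg w == d).

Lemma free_word_cat u v : free_word (u ++ v) = free_word u * free_word v.
Proof. by rewrite /free_word malgUM; congr << _ >>; apply/eqP; rewrite fmP fmM. Qed.

Lemma free_word_span (W : set A) :
  subspace W -> (forall w, W (free_word w)) -> forall a, W a.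
Proof. by move=> sW Ww; apply: subspace_words => // w; rewrite -(fmK w); exact: Ww. Qed.

(** A condition on the support of an element says that the corresponding projection fixes it, so the
    two notions of homogeneity agree. *)
Lemma lcsE k : @lcs K m n k = L free_pproj k.
Proof.
have parityE p a : parity_part p a <-> homog free_pproj p a.
  by rewrite /homog /free_pproj -restr_id; split=> Pa w /Pa /eqP.
elim: k => [|[|k] IHk] //; rewrite LS //.
rewrite -[LHS]/(scomm_space (lcs k.+1)) IHk.
congr (lin_span _); apply/seteqP; split=> _ [p [q [a [b [Pa Pb Lb ->]]]]];
  by exists p, q, a, b; split=> //; apply/parityE.
Qed.

Lemma free_B_dim_growth k : [pchar K] =i pred0 -> (1 < k)%N ->
  exists C, forall d, exists2 N,
    (N <= C * (m + n) * d.+1 ^ (m + n).-1)%N & B_dim K m n k d N.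
Proof.
move=> char0 k1.
have [C CP] := @B_dim_growth K A gen (@odd_gen m n) free_word free_pproj free_dproj
  (@malg_scalerAr K (sword m n)) free_word_cat free_word_span
  (fun p => @restr_linear K (sword m n) _) (fun d => @restr_linear K (sword m n) _)
  (fun p w => restrU _ _ _) (fun d w => restrU _ _ _) char0 k k1.
exists C => d; have [N NC quot] := CP d; exists N; first by rewrite card_sum !card_ord in NC.
rewrite /B_dim !lcsE; congr (has_quot_dim (_ `&` _) _ _): quot.
apply/seteqP; split=> a; rewrite /= /free_dproj -restr_id.
  by move=> da w /da /eqP.
by move=> da w /da ->.
Qed.

End FreeSuperalgebra.

Theorem corollary1p9 (R : realType) (k m n : nat) (hk : (3 <= k)%N) :
  exists C : R, forall d : nat, (1 <= d)%N ->
    exists N : nat,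
      B_dim R[i] m n k d N /\ N%:R <= C * d%:R ^ (m%:Z + n%:Z - 1).
Proof.
have [C CP] := @free_B_dim_growth R[i] m n k (@Num.Theory.pchar_num _) (ltnW hk).
(* The power of 2 comes from d + 1 <= 2d, valid for d at least 1. *)
exists (C * (m + n) * 2 ^ (m + n).-1)%:R => d d0.
have [N NC BN] := CP d; exists N; split=> //.
(* Without generators the bound forces N = 0; otherwise m + n - 1 is a natural exponent. *)
have [mn0|mn_gt0] := posnP (m + n).
  by move: NC; rewrite mn0 muln0 mul0n leqn0 => /eqP ->; rewrite mul0r.
have -> : (m%:Z + n%:Z - 1)%R = (m + n).-1%:Z by rewrite -PoszD -subn1 subzn.
rewrite -exprnP -natrX -natrM Num.Theory.ler_nat (leq_trans NC) //.
rewrite -[leqRHS]mulnA leq_mul2l -expnMn.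
by apply/orP; right; apply: leq_expn; rewrite mul2n -addnn -addn1 leq_add2l.
Qed.
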